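(* There are two $K$-orbits, $\Sigma_{16}$ and $\Sigma_{17}$, of planes $\pi$ in $\mathrm{PG}(5,q)$ which are disjoint from the Veronese surface $\mathcal{V}(\mathbb{F}_q)$, and meet the nucleus plane of $\mathcal{V}(\mathbb{F}_q)$ in a line. These two $K$-orbits are characterised by their point-orbit distributions $OD_0(\Sigma_{16})=[0,q+1,0,q^2]$ and $OD_0(\Sigma_{17})=[0,q+1,q,q^2-q]$. Representatives are $\Sigma_{16}:[\cdot,x,z;\ x,z,y;\ z,y,\cdot]$ and $\Sigma_{17}:[\cdot,x,y;\ x,z,\cdot;\ y,\cdot,z]$.
   Context: Let $q$ be even. The Veronese surface $\mathcal{V}(\mathbb{F}_q)\subset\mathrm{PG}(5,q)$ is the image of $(u_0,u_1,u_2)\mapsto(u_0^2,u_0u_1,u_0u_2,u_1^2,u_1u_2,u_2^2)$; a point $(y_0,\dots,y_5)$ is identified with the symmetric matrix $[y_0,y_1,y_2;\ y_1,y_3,y_4;\ y_2,y_4,y_5]$ and has the rank of this matrix; planes are written as symmetric matrices with entries linear forms in $x,y,z$ (''$\cdot$'' = zero). $K\cong\mathrm{PGL}(3,q)$ acts by $M\mapsto AMA^T$. The nucleus plane is $\pi_{\mathcal{N}}=\mathcal{Z}(Y_0,Y_3,Y_5)$. The point-orbit distribution $OD_0(\pi)=[r_1,r_{2,n},r_{2,s},r_3]$ counts rank-1 points, points in $\pi\cap\pi_{\mathcal{N}}$, rank-2 points outside $\pi_{\mathcal{N}}$, and rank-3 points of $\pi$. *)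

(* Defs.v *)
From HB Require Import structures.
From mathcomp Require Import all_boot all_order all_fingroup all_algebra.

Set Implicit Arguments.
Unset Strict Implicit.
Unset Printing Implicit Defensive.

Import GRing.Theory VectorInternalTheory.
Local Open Scope ring_scope.

(* Over a finite field the subspaces of a fixed space form a finite type, so   *)
(* that points, planes and orbits can be collected in finite sets.             *)
HB.instance Definition _ (F : finFieldType) (vT : vectType F) :=
  [Countable of {vspace vT} by <:].
HB.instance Definition _ (F : finFieldType) (vT : vectType F) :=
  [Finite of {vspace vT} by <:].

Section ProjectiveSpace.

Variable F : finFieldType.

(* Subspaces of PG(5,q) are linear subspaces of F^6, of vector space dimension *)
(* one more than their projective dimension.                                   *)
Notation subspace := {vspace 'rV[F]_6}.

Definition is_point (P : subspace) : bool := \dim P == 1%N.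
Definition is_line (L : subspace) : bool := \dim L == 2%N.
Definition is_plane (U : subspace) : bool := \dim U == 3%N.

Definition points (U : subspace) : {set subspace} :=
  [set P : subspace | is_point P & (P <= U)%VS].

Definition sym_mx (a b c d e f : F) : 'M[F]_3 :=
  \matrix_(i < 3, j < 3)
    (nth [::] [:: [:: a; b; c];
                  [:: b; d; e];
                  [:: c; e; f]] i)`_j.

Definition mx_of_vec (y : 'rV[F]_6) : 'M[F]_3 :=
  let Y k := y 0 (inord k) in
  sym_mx (Y 0%N) (Y 1%N) (Y 2%N) (Y 3%N) (Y 4%N) (Y 5%N).

(* Only the upper triangular entries are read; this inverts mx_of_vec on       *)
(* symmetric matrices.                                                         *)
Definition vec_of_mx (M : 'M[F]_3) : 'rV[F]_6 :=
  let m i j := M (inord i) (inord j) in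
  \row_(k < 6)
    [:: m 0 0; m 0 1; m 0 2; m 1 1; m 1 2; m 2 2]%N`_k.

(* For a point P the nonzero vector vpick P spans P, and the rank does not     *)
(* depend on the choice of that vector.                                        *)
Definition point_rank (P : subspace) : nat := \rank (mx_of_vec (vpick P)).

Definition veronese_vec (u : 'rV[F]_3) : 'rV[F]_6 :=
  let v i := u 0 (inord i) in
  \row_(k < 6)
    [:: v 0%N ^+ 2; v 0%N * v 1%N; v 0%N * v 2%N;
        v 1%N ^+ 2; v 1%N * v 2%N; v 2%N ^+ 2]`_k.

Definition veronese_surface : {set subspace} :=
  [set <[veronese_vec u]>%VS | u : 'rV[F]_3 & u != 0].

(* The hyperplane Z(Y_k).                                                      *)
Definition coord_hyperplane (k : nat) : subspace :=
  lker (linfun (col (inord k) : 'rV[F]_6 -> 'cV[F]_1)).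

Definition nucleus_plane : subspace :=
  (coord_hyperplane 0 :&: coord_hyperplane 3 :&: coord_hyperplane 5)%VS.

Definition K_act (A : 'M[F]_3) (y : 'rV[F]_6) : 'rV[F]_6 :=
  vec_of_mx (A *m mx_of_vec y *m A^T).

(* linfun f agrees with f only for linear f, hence this instance.              *)
Fact K_act_is_linear (A : 'M[F]_3) : linear (K_act A).
Proof.
have mxL a (y z : 'rV[F]_6) :
  mx_of_vec (a *: y + z) = a *: mx_of_vec y + mx_of_vec z.
  apply/matrixP=> i j; rewrite !mxE.
  by case: i => [[|[|[|i]]] //= _]; case: j => [[|[|[|j]]] //= _]; rewrite !mxE.
have vecL a (M N : 'M[F]_3) :
  vec_of_mx (a *: M + N) = a *: vec_of_mx M + vec_of_mx N.
  apply/rowP=> k; rewrite !mxE.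
  by case: k => [[|[|[|[|[|[|k]]]]]] //= _]; rewrite !mxE.
move=> a y z.
by rewrite /K_act mxL mulmxDr mulmxDl -scalemxAr -scalemxAl vecL.
Qed.

HB.instance Definition _ (A : 'M[F]_3) :=
  GRing.isLinear.Build F 'rV[F]_6 'rV[F]_6 _ (K_act A) (K_act_is_linear A).

(* Scalar matrices fix every subspace, so that the orbits of PGL(3,q) are      *)
(* those of GL(3,q).                                                           *)
Definition K_orbit (U : subspace) : {set subspace} :=
  [set (linfun (K_act A) @: U)%VS | A : 'M[F]_3 in unitmx].

(* [r_1, r_{2,n}, r_{2,s}, r_3]                                                *)
Definition OD0 (U : subspace) : seq nat :=
  [:: #|[set P in points U | point_rank P == 1]|;
      #|points (U :&: nucleus_plane)|;
      #|[set P in points U | (point_rank P == 2) && ~~ (P <= nucleus_plane)%VS]|;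
      #|[set P in points U | point_rank P == 3]|]%N.

(* The subspace of all points M(x,y,z), for a matrix M of linear forms; for    *)
(* linear M the values already form a subspace and the span adds nothing.      *)
Definition subspace_of_forms (M : F -> F -> F -> 'M[F]_3) : subspace :=
  <<[seq vec_of_mx (M t.1.1 t.1.2 t.2) | t : F * F * F]>>%VS.

Definition Sigma16 : {set subspace} :=
  K_orbit (subspace_of_forms (fun x y z => sym_mx 0 x z
                                                    z y
                                                      0)).

Definition Sigma17 : {set subspace} :=
  K_orbit (subspace_of_forms (fun x y z => sym_mx 0 x y
                                                    z 0
                                                      z)).

End ProjectiveSpace.

(* Main.v *)
Require Import Defs.
From mathcomp Require Import all_boot all_order all_fingroup all_algebra.
From mathcomp Require Import all_solvable all_field ring zify.

(* A zero-diagonal symmetric 3 x 3 matrix in characteristic 2 is alternating,  *)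
(* and so is u w^T + w u^T for vectors u, w; a line of the nucleus plane is    *)
(* the set of these for some fixed u. Moving u to the first basis vector, a    *)
(* plane U meeting the nucleus plane in a line becomes                         *)
(*   [z a, x, y; x, z d, z e; y, z e, z f]   with (a, d, f) != 0.              *)
(* Square roots exist in F, so U meets the Veronese surface exactly when       *)
(* e^2 = d f. Otherwise the lower right block is a nonsingular symmetric form, *)
(* which is alternating (d = f = 0, giving Sigma16) or congruent to a multiple *)
(* of the identity (giving Sigma17). The point-orbit distribution of U         *)
(* determines both that it meets the hypotheses and in which orbit it lies.    *)

Set Implicit Arguments.
Unset Strict Implicit.
Unset Printing Implicit Defensive.

Import GRing.Theory.
Local Open Scope ring_scope.

(** In characteristic 2 the diagonal of A M A^T depends only on the diagonal of M, so the nucleus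
    plane is [K]-stable and [OD0] is constant on orbits ([OD0_K_image]). Two things remain: to
    reduce every admissible plane to one of two representatives, and to compute their distributions.

    For the reduction, [move_nucleus_line] brings the line in the nucleus plane to a standard one,
    [plane_normal_form] writes the rest of the plane as multiples of a single matrix, and
    [orbit16_or_17] normalises the lower right 2 x 2 block, whose determinant e^2 + d f is nonzero
    because the plane misses the Veronese surface.

    For the distributions, the generic matrix has determinant z^3 on [plane16] and z (x + y)^2 on
    [plane17], while z = 0 is the nucleus line. Hence there are 0, respectively q, rank-2 points off
    the nucleus plane, and the other entries follow by counting ([OD0_plane]).

    Conversely, the entries r_1 = 0 and r_{2,n} = q + 1 alone give back the two geometric hypotheses
    ([disjoint_veronese_OD0], [is_line_card_points]), and r_{2,s} then decides the orbit. *)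

(** * Coordinates on symmetric 3 x 3 matrices *)

Section Coordinates.

Variable F : finFieldType.
Implicit Types (y v : 'rV[F]_6) (A B M : 'M[F]_3).

Local Notation o i := (@Ordinal 3 i%N isT).

Lemma inord_eq n (i : 'I_n.+1) (k : nat) : k = i -> inord k = i.
Proof. by move=> ->; exact: fintype.inord_val. Qed.

Lemma inord3 : ((inord 0%N = o 0) * (inord 1%N = o 1) * (inord 2%N = o 2))%type.
Proof. by split; [split|]; apply: inord_eq. Qed.

Lemma sum_ord3 (V : nmodType) (f : 'I_3 -> V) : \sum_i f i = f (o 0) + f (o 1) + f (o 2).
Proof.
rewrite !big_ord_recr big_ord0 /= add0r; congr (f _ + f _ + f _); exact: val_inj.
Qed.

Lemma ord3P (P : 'I_3 -> Prop) : P (o 0) -> P (o 1) -> P (o 2) -> forall i, P i.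
Proof.
move=> P0 P1 P2 [[|[|[|//]]] lti].
- by rewrite (_ : Ordinal lti = o 0) //; apply: val_inj.
- by rewrite (_ : Ordinal lti = o 1) //; apply: val_inj.
- by rewrite (_ : Ordinal lti = o 2) //; apply: val_inj.
Qed.

Definition sym_vec (a b c d e f : F) : 'rV[F]_6 := vec_of_mx (sym_mx a b c d e f).

Lemma vec_of_mxE M :
  vec_of_mx M = sym_vec (M (o 0) (o 0)) (M (o 0) (o 1)) (M (o 0) (o 2))
                        (M (o 1) (o 1)) (M (o 1) (o 2)) (M (o 2) (o 2)).
Proof. by apply/rowP=> k; rewrite !mxE /= !inord3 ?mxE. Qed.

Lemma mx_of_sym_vec a b c d e f : mx_of_vec (sym_vec a b c d e f) = sym_mx a b c d e f.
Proof. by rewrite /mx_of_vec !mxE !inordK // !inord3 !mxE. Qed.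

Lemma mx_of_vecK y : vec_of_mx (mx_of_vec y) = y.
Proof.
apply/rowP=> k; rewrite mxE !inord3 !mxE /=.
by case: k => [[|[|[|[|[|[|//]]]]]] ltk] /=; congr (y _ _); apply: inord_eq.
Qed.

Lemma mx_of_vec_inj : injective (@mx_of_vec F).
Proof. exact: can_inj mx_of_vecK. Qed.

Lemma sym_vecP y : exists a b c d e f, y = sym_vec a b c d e f.
Proof. by rewrite -(mx_of_vecK y); do 6!eexists; reflexivity. Qed.

Lemma sym_vec_inj a b c d e f a' b' c' d' e' f' :
  sym_vec a b c d e f = sym_vec a' b' c' d' e' f' ->
  [/\ a = a', b = b' & c = c'] /\ [/\ d = d', e = e' & f = f'].
Proof.
move/(congr1 (@mx_of_vec F)); rewrite !mx_of_sym_vec => /matrixP eqM.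
have := (eqM (o 0) (o 0), eqM (o 0) (o 1), eqM (o 0) (o 2)).
have := (eqM (o 1) (o 1), eqM (o 1) (o 2), eqM (o 2) (o 2)).
by rewrite !mxE /= => -[[-> ->] ->] [[-> ->] ->].
Qed.

Lemma sym_vec0 : sym_vec 0 0 0 0 0 0 = 0.
Proof. by apply/rowP; case=> [[|[|[|[|[|[|//]]]]]] ltk]; rewrite !mxE /= ?inord3 ?mxE. Qed.

Lemma sym_vecD a b c d e f a' b' c' d' e' f' :
  sym_vec a b c d e f + sym_vec a' b' c' d' e' f' =
  sym_vec (a + a') (b + b') (c + c') (d + d') (e + e') (f + f').
Proof.
apply/rowP=> k; rewrite !mxE !inord3 /=.
by case: k => [[|[|[|[|[|[|//]]]]]] ltk].
Qed.

Lemma sym_vecZ k a b c d e f :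
  k *: sym_vec a b c d e f = sym_vec (k * a) (k * b) (k * c) (k * d) (k * e) (k * f).
Proof.
apply/rowP=> i; rewrite !mxE !inord3 /=.
by case: i => [[|[|[|[|[|[|//]]]]]] lti].
Qed.

Lemma mx_of_vecZ k y : mx_of_vec (k *: y) = k *: mx_of_vec y.
Proof.
have [a [b [c [d [e [f ->]]]]]] := sym_vecP y.
by rewrite sym_vecZ !mx_of_sym_vec; apply/matrixP; do 2!apply: ord3P; rewrite !mxE.
Qed.

Lemma mx_of_vec_eq0 y : (mx_of_vec y == 0) = (y == 0).
Proof.
by rewrite -(inj_eq mx_of_vec_inj) -[in RHS](scale0r 0) mx_of_vecZ scale0r.
Qed.

Lemma mx_of_vec_sym y : (mx_of_vec y)^T = mx_of_vec y.
Proof. by apply/matrixP; do 2!apply: ord3P; rewrite !mxE. Qed.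

Lemma vec_of_mxK M : M^T = M -> mx_of_vec (vec_of_mx M) = M.
Proof.
move=> symM; rewrite vec_of_mxE mx_of_sym_vec.
by apply/matrixP; do 2!apply: ord3P; rewrite mxE //= -[in RHS]symM mxE.
Qed.

Definition mx3 (a b c d e f g h i : F) : 'M[F]_3 :=
  \matrix_(s < 3, t < 3) (nth [::] [:: [:: a; b; c]; [:: d; e; f]; [:: g; h; i]] s)`_t.

Lemma mx3P A : exists a b c d e f g h i, A = mx3 a b c d e f g h i.
Proof.
exists (A (o 0) (o 0)), (A (o 0) (o 1)), (A (o 0) (o 2)),
  (A (o 1) (o 0)), (A (o 1) (o 1)), (A (o 1) (o 2)),
  (A (o 2) (o 0)), (A (o 2) (o 1)), (A (o 2) (o 2)).
by apply/matrixP; do 2!apply: ord3P; rewrite mxE.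
Qed.

Lemma det_mx3 a b c d e f g h i :
  \det (mx3 a b c d e f g h i) =
  a * (e * i - f * h) - b * (d * i - f * g) + c * (d * h - e * g).
Proof.
do 3!rewrite ?(expand_det_row _ ord0) ?big_ord_recl ?big_ord0 /cofactor ?det_mx11.
rewrite !mxE /= /bump /=; ring.
Qed.

(** The cross terms on the diagonal occur twice and vanish in characteristic 2, leaving squares; off
    the diagonal, [y1], [y2], [y4] are multiplied by the 2 x 2 minors of the matrix. *)
Lemma K_act_mx3 (a b c d e f g h i y0 y1 y2 y3 y4 y5 : F) :
  (2 = 0 :> F) ->
  K_act (mx3 a b c d e f g h i) (sym_vec y0 y1 y2 y3 y4 y5) =
  sym_vec (a ^+ 2 * y0 + b ^+ 2 * y3 + c ^+ 2 * y5)
    ((a * e + b * d) * y1 + (a * f + c * d) * y2 + (b * f + c * e) * y4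
     + a * d * y0 + b * e * y3 + c * f * y5)
    ((a * h + b * g) * y1 + (a * i + c * g) * y2 + (b * i + c * h) * y4
     + a * g * y0 + b * h * y3 + c * i * y5)
    (d ^+ 2 * y0 + e ^+ 2 * y3 + f ^+ 2 * y5)
    ((d * h + e * g) * y1 + (d * i + f * g) * y2 + (e * i + f * h) * y4
     + d * g * y0 + e * h * y3 + f * i * y5)
    (g ^+ 2 * y0 + h ^+ 2 * y3 + i ^+ 2 * y5).
Proof.
move=> char2; rewrite /K_act mx_of_sym_vec vec_of_mxE.
by congr sym_vec; rewrite !mxE !sum_ord3 !mxE !sum_ord3 !mxE /=; ring: char2.
Qed.

End Coordinates.

(** * The action on subspaces, and points as spans of vectors *)

Section Action.

Variable F : finFieldType.
Local Notation subspace := {vspace 'rV[F]_6}.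
Implicit Types (y v : 'rV[F]_6) (A B M : 'M[F]_3) (U V P : subspace).

Lemma mx_of_K_act A y : mx_of_vec (K_act A y) = A *m mx_of_vec y *m A^T.
Proof. by rewrite vec_of_mxK // !trmx_mul trmxK mx_of_vec_sym mulmxA. Qed.

Lemma K_actM A B y : K_act (A *m B) y = K_act A (K_act B y).
Proof. by rewrite /K_act -/(K_act B y) mx_of_K_act trmx_mul !mulmxA. Qed.

Lemma K_act1 y : K_act 1%:M y = y.
Proof. by rewrite /K_act trmx1 mul1mx mulmx1 mx_of_vecK. Qed.

Lemma K_actK A : A \in unitmx -> cancel (K_act A) (K_act (invmx A)).
Proof. by move=> uA y; rewrite -K_actM mulVmx ?K_act1. Qed.

Definition K_image A U : subspace := (linfun (K_act A) @: U)%VS.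

Lemma mem_K_image A U v : A \in unitmx -> (v \in K_image A U) = (K_act (invmx A) v \in U).
Proof.
move=> uA; apply/memv_imgP/idP => [[u Uu ->]|Uv].
  by rewrite lfunE K_actK.
exists (K_act (invmx A) v) => //.
by rewrite lfunE -[v in LHS](K_actK (A := invmx A)) ?invmxK ?unitmx_inv.
Qed.

Lemma K_imageM A B U : K_image A (K_image B U) = K_image (A *m B) U.
Proof.
rewrite /K_image -limg_comp; congr (_ @: _)%VS; apply/lfunP=> y.
by rewrite comp_lfunE !lfunE /= K_actM.
Qed.

Lemma K_image1 U : K_image 1%:M U = U.
Proof.
by apply/vspaceP=> v; rewrite mem_K_image ?unitmx1 // -{1}(mulmx1 (invmx _)) mulVmx ?unitmx1 // K_act1.
Qed.

Lemma K_imageK A : A \in unitmx -> cancel (K_image A) (K_image (invmx A)).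
Proof. by move=> uA U; rewrite K_imageM mulVmx ?K_image1. Qed.

Lemma K_image_line A v : K_image A <[v]> = <[K_act A v]>%VS.
Proof. by rewrite /K_image limg_line lfunE. Qed.

Lemma K_image_subv A U V : A \in unitmx -> (K_image A U <= K_image A V)%VS = (U <= V)%VS.
Proof.
move=> uA; apply/idP/idP; last exact: limgS.
by move/(limgS (linfun (K_act (invmx A)))); rewrite -/(K_image _ _) -/(K_image _ _) !K_imageK.
Qed.

Lemma dim_K_image A U : A \in unitmx -> \dim (K_image A U) = \dim U.
Proof.
move=> uA; apply: limg_dim_eq; apply/eqP; rewrite -subv0.
apply/subvP=> v /memv_capP[_]; rewrite memv_ker lfunE memv0 => /eqP v0.
by rewrite -(K_actK uA v) v0 linear0.
Qed.

Lemma K_orbit_refl U : U \in K_orbit U.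
Proof. by apply/imsetP; exists 1%:M; rewrite ?unitmx1 // -/(K_image _ _) K_image1. Qed.

Lemma K_orbit_K_image A U : A \in unitmx -> K_orbit (K_image A U) = K_orbit U.
Proof.
move=> uA; apply/setP=> V; apply/imsetP/imsetP => [] [B uB ->].
  by exists (B *m A); rewrite ?unitmx_mul ?uB // -/(K_image _ _) K_imageM.
exists (B *m invmx A); first by rewrite unitmx_mul unitmx_inv uA andbT.
by rewrite -!/(K_image _ _) K_imageM -mulmxA mulVmx ?mulmx1.
Qed.

Lemma K_orbitP V U : reflect (exists2 A, A \in unitmx & V = K_image A U) (V \in K_orbit U).
Proof. by apply: (iffP imsetP) => [] [A uA ->]; exists A. Qed.

(** An invertible matrix preserves dimension, so mapping [U] into [V] already maps it onto [V]. *)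
Lemma K_orbit_eq_of_mem A U V :
    A \in unitmx -> \dim U = \dim V -> (forall y, y \in U -> K_act A y \in V) ->
  K_orbit U = K_orbit V.
Proof.
move=> uA dimUV UV; rewrite -(K_orbit_K_image U uA); congr K_orbit.
apply/eqP; rewrite eqEdim dim_K_image // dimUV leqnn andbT.
by apply/subvP=> _ /memv_imgP[y Uy ->]; rewrite lfunE; exact: UV.
Qed.

Lemma is_pointP P : reflect (exists2 v, v != 0 & P = <[v]>%VS) (is_point P).
Proof.
apply: (iffP idP) => [/eqP dimP|[v nz_v ->]]; last by rewrite /is_point dim_vline nz_v.
have nz : vpick P != 0 by rewrite vpick0 -dimv_eq0 dimP.
by exists (vpick P) => //; apply/esym/eqP; rewrite eqEdim -memvE memv_pick dim_vline nz dimP.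
Qed.

Lemma pointsP P U : reflect (exists v, [/\ v != 0, v \in U & P = <[v]>%VS]) (P \in points U).
Proof.
rewrite inE; apply: (iffP andP) => [[/is_pointP[v nz_v ->]]|[v [nz_v Uv ->]]].
  by rewrite -memvE; exists v.
by split; [apply/is_pointP; exists v | rewrite -memvE].
Qed.

Lemma line_eqP v w : v != 0 -> reflect (exists2 k, k != 0 & v = k *: w) (<[v]> == <[w]>)%VS.
Proof.
move=> nz_v; apply: (iffP eqP) => [eq_vw|[k nz_k ->]].
  have /vlineP[k def_v] : v \in <[w]>%VS by rewrite -eq_vw memv_line.
  by exists k => //; apply: contraNneq nz_v => k0; rewrite def_v k0 scale0r.
apply/eqP; rewrite eqEsubv -!memvE memvZ ?memv_line //=.
by apply/vlineP; exists k^-1; rewrite scalerA mulVf ?scale1r.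
Qed.

Lemma point_rank_line v : v != 0 -> point_rank <[v]>%VS = \rank (mx_of_vec v).
Proof.
move=> nz_v; have nz : vpick <[v]>%VS != 0 by rewrite vpick0 -dimv_eq0 dim_vline nz_v.
have /vlineP[k def] := memv_pick <[v]>%VS.
rewrite /point_rank def mx_of_vecZ mxrank_scale_nz //.
by apply: contraNneq nz => k0; rewrite def k0 scale0r.
Qed.

Lemma mem_nucleus (a b c d e f : F) :
  (sym_vec a b c d e f \in nucleus_plane F) = [&& a == 0, d == 0 & f == 0].
Proof.
rewrite /nucleus_plane !memv_cap !memv_ker !lfunE -andbA.
have colE k : (col k (sym_vec a b c d e f) == 0) = (sym_vec a b c d e f 0 k == 0).
  apply/eqP/eqP => [/colP/(_ 0)|eq0]; first by rewrite !mxE.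
  by apply/colP=> i; rewrite !ord1 mxE eq0 mxE.
by rewrite !colE !mxE !inordK //= !inord3 !mxE.
Qed.

End Action.

(** * Invariance of the point-orbit distribution *)

Section Char2.

Variable F : finFieldType.
Hypothesis char2 : 2 = 0 :> F.
Local Notation subspace := {vspace 'rV[F]_6}.
Implicit Types (y v : 'rV[F]_6) (A B M : 'M[F]_3) (U V P : subspace).

(** By [K_act_mx3] the new diagonal is a combination of the old diagonal entries, so a zero diagonal
    stays zero. *)
Lemma K_image_nucleus A : A \in unitmx -> K_image A (nucleus_plane F) = nucleus_plane F.
Proof.
move=> uA; apply/eqP; rewrite eqEdim dim_K_image // leqnn andbT.
apply/subvP=> _ /memv_imgP[y Ny ->]; rewrite lfunE.
have [a [b [c [d [e [f def_y]]]]]] := sym_vecP y.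
move: Ny; rewrite {}def_y mem_nucleus => /and3P[/eqP-> /eqP-> /eqP->].
have [? [? [? [? [? [? [? [? [? ->]]]]]]]]] := mx3P A.
by rewrite /= K_act_mx3 // mem_nucleus !mulr0 !addr0 eqxx.
Qed.

Lemma point_rank_K_image A P : A \in unitmx -> is_point P -> point_rank (K_image A P) = point_rank P.
Proof.
move=> uA /is_pointP[v nz_v ->]; rewrite K_image_line !point_rank_line //; last first.
  by apply: contraNneq nz_v => v0; rewrite -(K_actK uA v) v0 linear0.
by rewrite mx_of_K_act mxrankMfree ?row_free_unit ?unitmx_tr // eqmxMfull ?row_full_unit.
Qed.

Lemma card_points_K_image (p : pred subspace) A U :
    A \in unitmx -> (forall P, is_point P -> p (K_image A P) = p P) ->
  #|[set P in points (K_image A U) | p P]| = #|[set P in points U | p P]|.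
Proof.
move=> uA pA; rewrite -[RHS](card_imset _ (can_inj (K_imageK uA))); apply: eq_card => P.
have is_pointA Q : is_point (K_image A Q) = is_point Q by rewrite /is_point dim_K_image.
have AVK : K_image A (K_image (invmx A) P) = P by rewrite K_imageM mulmxV ?K_image1.
apply/idP/imsetP => [|[Q]]; rewrite !inE.
  rewrite -AVK is_pointA K_image_subv // => /andP[/andP[ptP subP] pP].
  by exists (K_image (invmx A) P); rewrite // !inE ptP subP -pA.
by case/andP=> /andP[ptQ subQ] pQ ->; rewrite is_pointA ptQ K_image_subv // subQ pA.
Qed.

Lemma points_cap U V : points (U :&: V) = [set P in points U | (P <= V)%VS].
Proof. by apply/setP=> P; rewrite !inE subv_cap andbA. Qed.

Lemma OD0_K_image A U : A \in unitmx -> OD0 (K_image A U) = OD0 U.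
Proof.
move=> uA; rewrite /OD0 !points_cap.
have subN P : (K_image A P <= nucleus_plane F)%VS = (P <= nucleus_plane F)%VS.
  by rewrite -[in LHS](K_image_nucleus uA) K_image_subv.
by congr [:: _; _; _; _]; apply: card_points_K_image => // P ptP; rewrite ?subN ?point_rank_K_image.
Qed.

End Char2.

(** * Counting points by rank *)

Section Counting.

Variable F : finFieldType.
Local Notation subspace := {vspace 'rV[F]_6}.
Local Notation q := #|F|.
Implicit Types (y v : 'rV[F]_6) (A B M : 'M[F]_3) (U V P : subspace).

(** The nonzero vectors of [U] are partitioned by the points they span, each point receiving the q -
    1 nonzero multiples of one vector. *)
Lemma card_points U : (#|points U| * q.-1 = (q ^ \dim U).-1)%N.
Proof.
pose S := [set v in U | v != 0].
have fibre P : P \in points U -> (\sum_(v in S | <[v]>%VS == P) 1 = q.-1)%N.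
  case/pointsP=> w [nz_w Uw ->]; rewrite sum1_card.
  rewrite -(cardC1 (0 : F)) -(card_image (f := fun k : F => k *: w)); last first.
    move=> k l /eqP; rewrite -subr_eq0 -scalerBl scaler_eq0 (negPf nz_w) orbF.
    by rewrite subr_eq0 => /eqP.
  apply: eq_card => v; rewrite unfold_in /= inE; apply/andP/imageP => [[/andP[Uv nz_v]]|[k]].
    by case/line_eqP=> // k nz_k ->; exists k.
  rewrite inE /= => nz_k ->; rewrite memvZ // scaler_eq0 negb_or nz_k nz_w; split=> //.
  by apply/line_eqP; [rewrite scaler_eq0 negb_or nz_k | exists k].
rewrite -sum_nat_const -(eq_bigr _ fibre) -(partition_big (fun v => <[v]>%VS)) /=.
  rewrite sum1_card -card_vspace (cardD1 0 U) mem0v; apply: eq_card => v.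
  by rewrite !inE andbC.
by move=> v /[!inE] /andP[Uv nz_v]; apply/andP; rewrite -memvE; split=> //; apply/is_pointP; exists v.
Qed.

(** A matrix of rank 1 is a column times a row, so its 2 x 2 minors vanish. *)
Lemma rank1_minor (K : fieldType) m n (A : 'M[K]_(m, n)) i j k l :
  \rank A = 1%N -> A i j * A k l = A i l * A k j.
Proof.
move=> rkA; rewrite -(mulmx_base A); move: (col_base A) (row_base A).
rewrite rkA => C R; by rewrite !mxE !big_ord1 mulrACA [R _ _ * _]mulrC mulrACA.
Qed.

Lemma point_rank_gt0 P : is_point P -> (0 < point_rank P)%N.
Proof.
case/is_pointP=> v nz_v ->.
by rewrite point_rank_line // lt0n mxrank_eq0 mx_of_vec_eq0.
Qed.

Hypothesis char2 : 2 = 0 :> F.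

Lemma det_sym_mx (a b c d e f : F) :
  \det (sym_mx a b c d e f) = a * d * f + a * e ^+ 2 + d * c ^+ 2 + f * b ^+ 2.
Proof.
rewrite (det_mx3 a b c b d e c e f) -[RHS]addr0.
rewrite -(mul0r (b * c * e - a * e ^+ 2 - d * c ^+ 2 - f * b ^+ 2)) -char2; ring.
Qed.

Lemma rank3_sym_mx (a b c d e f : F) :
  (\rank (sym_mx a b c d e f) == 3%N) =
  (a * d * f + a * e ^+ 2 + d * c ^+ 2 + f * b ^+ 2 != 0).
Proof. by rewrite -det_sym_mx -unitfE -unitmxE -row_free_unit. Qed.

Lemma rank1_sym_mx (a b c d e f : F) : \rank (sym_mx a b c d e f) = 1%N ->
  [/\ b ^+ 2 = a * d, c ^+ 2 = a * f & e ^+ 2 = d * f].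
Proof.
move=> rk1; have minor i j k l := @rank1_minor _ _ _ _ i j k l rk1.
pose o i := inord i : 'I_3.
have := (minor (o 0%N) (o 0%N) (o 1%N) (o 1%N), minor (o 0%N) (o 0%N) (o 2%N) (o 2%N),
         minor (o 1%N) (o 1%N) (o 2%N) (o 2%N)).
by rewrite /o !inord3 !mxE /= !expr2 => -[[-> ->] ->].
Qed.

(** With zero diagonal the determinant is 0, which excludes rank 3; rank 1 would make the squares of
    the off-diagonal entries vanish. *)
Lemma point_rank_nucleus P :
  is_point P -> (P <= nucleus_plane F)%VS -> point_rank P = 2%N.
Proof.
move=> ptP; have := point_rank_gt0 ptP; case/is_pointP: ptP => v nz_v ->.
rewrite point_rank_line // -memvE.
have [a [b [c [d [e [f def_v]]]]]] := sym_vecP v.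
rewrite def_v mem_nucleus mx_of_sym_vec => + /and3P[/eqP a0 /eqP d0 /eqP f0].
rewrite a0 d0 f0 in def_v *.
have := rank3_sym_mx 0 b c 0 e 0; have := @rank1_sym_mx 0 b c 0 e 0.
have := rank_leq_row (sym_mx 0 b c 0 e 0).
case: (\rank _) => [|[|[|[|r]]]] //= _.
  move=> /(_ erefl)[/eqP + /eqP + /eqP].
  rewrite !mul0r !expf_eq0 /= => /eqP b0 /eqP c0 /eqP e0.
  by rewrite def_v b0 c0 e0 sym_vec0 eqxx in nz_v.
by rewrite !mul0r !addr0 !eqxx => _ /esym.
Qed.

(** The four classes partition the points, since every point of the nucleus plane has rank 2. *)
Lemma sum_OD0 U : sumn (OD0 U) = #|points U|.
Proof.
have cardE (p : pred subspace) :
  #|[set P in points U | p P]| = (\sum_(P in points U) p P)%N.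
  by rewrite -sum1dep_card big_mkcondr /=; apply: eq_bigr => P _; case: (p P).
rewrite /OD0 points_cap !cardE /= addn0 -!big_split -sum1_card.
apply: eq_bigr => P /[!inE] /andP[ptP _].
have := point_rank_gt0 ptP; have := @point_rank_nucleus P ptP.
have : (point_rank P <= 3)%N by exact: rank_leq_row.
case: (P <= _)%VS => [_ /(_ isT) ->|] //.
by case: (point_rank P) => [|[|[|[|r]]]].
Qed.

Lemma disjoint_veronese U :
  reflect (forall u : 'rV[F]_3, u != 0 -> veronese_vec u \notin U)
          [disjoint points U & veronese_surface F].
Proof.
have nz_ver (u : 'rV[F]_3) : u != 0 -> veronese_vec u != 0.
  apply: contraNneq => /rowP ver0; apply/eqP/rowP; apply: ord3P;
    [have := ver0 (inord 0) | have := ver0 (inord 3) | have := ver0 (inord 5)];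
    by rewrite !mxE inordK //= inord3 => /eqP; rewrite expf_eq0 => /eqP.
apply: (iffP pred0P) => [dis u nz_u|notU P /=].
  have Vu : <[veronese_vec u]>%VS \in veronese_surface F by apply/imsetP; exists u; rewrite ?inE.
  apply/negP=> Uu; have := dis <[veronese_vec u]>%VS; rewrite /= Vu andbT.
  by case/negP; apply/pointsP; exists (veronese_vec u); rewrite nz_ver.
apply/negP=> /andP[+ /imsetP[u nz_u def_P]]; rewrite {}def_P inE -memvE => /andP[_ Uu].
by rewrite inE in nz_u; have := notU u nz_u; rewrite Uu.
Qed.

Lemma veronese_vecE (u : 'rV[F]_3) : veronese_vec u = vec_of_mx (u^T *m u).
Proof.
by apply/rowP=> -[[|[|[|[|[|[|//]]]]]] ltk]; rewrite !mxE /= ?big_ord1 ?mxE ?expr2.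
Qed.

(** A point of the Veronese surface has matrix u^T u with u a nonzero row, hence rank 1. *)
Lemma disjoint_veronese_OD0 U :
  nth 0%N (OD0 U) 0 = 0%N -> [disjoint points U & veronese_surface F].
Proof.
move/eqP; rewrite cards_eq0 => /eqP/setP r1_0; apply/disjoint_veronese => u nz_u.
have rk1 : \rank (mx_of_vec (veronese_vec u)) = 1%N.
  rewrite veronese_vecE vec_of_mxK; last by rewrite trmx_mul trmxK.
  apply/eqP; rewrite eqn_leq (leq_trans (mxrankM_maxl _ _)) ?rank_leq_col //=.
  rewrite lt0n mxrank_eq0; apply: contraNneq nz_u => /matrixP uu0.
  apply/eqP/rowP=> i; have /eqP := uu0 i i.
  by rewrite !mxE big_ord1 !mxE -expr2 expf_eq0 => /eqP.
have nz_v : veronese_vec u != 0 by rewrite -mx_of_vec_eq0 -mxrank_eq0 rk1.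
have ptv : is_point <[veronese_vec u]>%VS by apply/is_pointP; exists (veronese_vec u).
by apply/negP=> Uu; have := r1_0 <[veronese_vec u]>%VS; rewrite !inE ptv point_rank_line // rk1 -memvE Uu.
Qed.

End Counting.

(** * The two representatives and their distributions *)

Section Representatives.

Variable F : finFieldType.
Local Notation subspace := {vspace 'rV[F]_6}.
Local Notation q := #|F|.
Implicit Types (v : 'rV[F]_6) (U P : subspace).

Lemma card_points_line U : is_line U -> #|points U| = (q + 1)%N.
Proof.
move/eqP=> dimU; have := card_points U; have := finNzRing_gt1 F; rewrite dimU.
by case: #|F| => [|[|n]] // _ /eqP; rewrite -[_.-1]/(n.+1) => /eqP; nia.
Qed.

Lemma card_points_plane U : is_plane U -> #|points U| = (q ^ 2 + q + 1)%N.
Proof.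
move/eqP=> dimU; have := card_points U; have := finNzRing_gt1 F; rewrite dimU.
case: #|F| => [|[|n]] // _; rewrite !expnS expn0 !muln1 /= => H; nia.
Qed.

Lemma is_line_card_points U : #|points U| = (q + 1)%N -> is_line U.
Proof.
move=> cardU; have := card_points U; have q_gt1 := finNzRing_gt1 F; rewrite cardU => eqU.
apply/eqP/(expnI q_gt1).
have : (0 < q ^ \dim U)%N by rewrite expn_gt0 ltnW.
move: q_gt1 eqU; case: #|F| => [|[|n]] // _; move: (_ ^ _)%N => m.
rewrite -[_.-1 in X in (_ * X)%N]/(n.+1) !expnS expn0 !muln1; nia.
Qed.

Lemma dim_codom (T : finType) (g : T -> 'rV[F]_6) n U :
  injective g -> U =i codom g -> #|T| = (q ^ n)%N -> \dim U = n.
Proof.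
move=> g_inj Ug cardT; apply: (expnI (finNzRing_gt1 F)).
by rewrite -card_vspace -cardT -(card_codom g_inj); apply: eq_card.
Qed.

(** The values of a linear parametrisation are closed under combinations, so their span consists of
    values only. This makes the representatives explicit sets of vectors. *)
Lemma subspace_of_formsE (M : F -> F -> F -> 'M[F]_3) :
    (forall k x y z x' y' z', vec_of_mx (M (k * x + x') (k * y + y') (k * z + z')) =
       k *: vec_of_mx (M x y z) + vec_of_mx (M x' y' z')) ->
  subspace_of_forms M =i codom (fun t : F * F * F => vec_of_mx (M t.1.1 t.1.2 t.2)).
Proof.
move=> linM v; apply/idP/idP => [|/codomP[t ->]]; last exact/memv_span/image_f.
set g := fun t => _; rewrite /subspace_of_forms -/g => /(@coord_span _ _ _ (in_tuple _)) ->.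
have linG k t u : exists w, k *: g t + g u = g w.
  by exists (k * t.1.1 + u.1.1, k * t.1.2 + u.1.2, k * t.2 + u.2); rewrite /g linM.
(* Zero is the combination -g(0) + g(0), hence itself a value. *)
have g0 : 0 \in codom g.
  by have [w] := linG (-1) (0, 0, 0) (0, 0, 0); rewrite scaleN1r addNr => ->; exact: codom_f.
apply: (big_ind (fun v => v \in codom g)) => // [_ _ /codomP[t ->] /codomP[u ->]|i _].
  by have [w] := linG 1 t u; rewrite scale1r => ->; exact: codom_f.
have /imageP[t _ ->] : (in_tuple (image g predT))`_i \in image g predT by apply: mem_nth.
have /codomP[u g_u] := g0; have [w] := linG (coord (in_tuple (image g predT)) i v) t u.
by rewrite -g_u addr0 => ->; exact: codom_f.
Qed.

Hypothesis char2 : 2 = 0 :> F.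

(** The plane has q^2 + q + 1 points, of which q + 1 lie in the nucleus plane, so the last entry is
    forced. *)
Lemma OD0_plane U s :
    is_plane U -> is_line (U :&: nucleus_plane F) ->
    (forall v, v \in U -> \rank (mx_of_vec v) != 1%N) ->
    #|[set P in points U | (point_rank P == 2%N) && ~~ (P <= nucleus_plane F)%VS]| = s ->
  OD0 U = [:: 0; q + 1; s; q ^ 2 - s]%N.
Proof.
move=> planeU lineU noV card_s; have := sum_OD0 char2 U.
have r1_0 : #|[set P in points U | point_rank P == 1%N]| = 0%N.
  apply: eq_card0 => P; apply/negP; rewrite inE => /andP[/pointsP[v [nz_v Uv ->]]].
  by rewrite point_rank_line //; apply/negP/noV.
rewrite /OD0 r1_0 card_points_line // card_s card_points_plane //= => eq_sum.
by congr [:: _; _; _; _]; lia.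
Qed.

Definition plane16 := subspace_of_forms (fun x y z : F => sym_mx 0 x z z y 0).
Definition plane17 := subspace_of_forms (fun x y z : F => sym_mx 0 x y z 0 z).

Lemma plane16E : plane16 =i codom (fun t : F * F * F => sym_vec 0 t.1.1 t.2 t.2 t.1.2 0).
Proof.
apply: subspace_of_formsE => k x y z x' y' z'.
by rewrite -!/(sym_vec _ _ _ _ _ _) sym_vecZ sym_vecD mulr0 addr0.
Qed.

Lemma plane17E : plane17 =i codom (fun t : F * F * F => sym_vec 0 t.1.1 t.1.2 t.2 0 t.2).
Proof.
apply: subspace_of_formsE => k x y z x' y' z'.
by rewrite -!/(sym_vec _ _ _ _ _ _) sym_vecZ sym_vecD mulr0 addr0.
Qed.

Lemma mem_plane16 (x y z : F) : sym_vec 0 x z z y 0 \in plane16.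
Proof. by rewrite plane16E; apply/codomP; exists (x, y, z). Qed.

Lemma mem_plane17 (x y z : F) : sym_vec 0 x y z 0 z \in plane17.
Proof. by rewrite plane17E; apply/codomP; exists (x, y, z). Qed.

Lemma plane16P v : v \in plane16 -> exists x y z, v = sym_vec 0 x z z y 0.
Proof. by rewrite plane16E => /codomP[[[x y] z] ->]; exists x, y, z. Qed.

Lemma plane17P v : v \in plane17 -> exists x y z, v = sym_vec 0 x y z 0 z.
Proof. by rewrite plane17E => /codomP[[[x y] z] ->]; exists x, y, z. Qed.

Lemma is_plane16 : is_plane plane16.
Proof.
apply/eqP/(dim_codom _ plane16E); last by rewrite !card_prod !expnS expn0 muln1 mulnA.
by move=> [[x y] z] [[x' y'] z'] /sym_vec_inj[[_ /= -> ->] [_ -> _]].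
Qed.

Lemma is_plane17 : is_plane plane17.
Proof.
apply/eqP/(dim_codom _ plane17E); last by rewrite !card_prod !expnS expn0 muln1 mulnA.
by move=> [[x y] z] [[x' y'] z'] /sym_vec_inj[[_ /= -> ->] [-> _ _]].
Qed.

Lemma is_line16 : is_line (plane16 :&: nucleus_plane F).
Proof.
apply/eqP/(@dim_codom _ (fun t : F * F => sym_vec 0 t.1 0 0 t.2 0)).
- by move=> [x y] [x' y'] /sym_vec_inj[[_ /= -> _] [_ -> _]].
- move=> v; apply/memv_capP/codomP => [[/plane16P[x [y [z ->]]]]|[[x y] ->]].
    by rewrite mem_nucleus => /and3P[_ /eqP-> _]; exists (x, y).
  by rewrite mem_plane16 mem_nucleus eqxx.
- by rewrite card_prod !expnS expn0 muln1.
Qed.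

Lemma is_line17 : is_line (plane17 :&: nucleus_plane F).
Proof.
apply/eqP/(@dim_codom _ (fun t : F * F => sym_vec 0 t.1 t.2 0 0 0)).
- by move=> [x y] [x' y'] /sym_vec_inj[[_ /= -> ->] _].
- move=> v; apply/memv_capP/codomP => [[/plane17P[x [y [z ->]]]]|[[x y] ->]].
    by rewrite mem_nucleus => /and3P[_ /eqP-> _]; exists (x, y).
  by rewrite mem_plane17 mem_nucleus eqxx.
- by rewrite card_prod !expnS expn0 muln1.
Qed.

Lemma rank_sym_mx0 : \rank (sym_mx 0 0 0 0 0 0 : 'M[F]_3) = 0%N.
Proof. by apply/eqP; rewrite -mx_of_sym_vec mxrank_eq0 mx_of_vec_eq0 sym_vec0. Qed.

Lemma OD0_plane16 : OD0 plane16 = [:: 0; q + 1; 0; q ^ 2]%N.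
Proof.
rewrite -[X in [:: _; _; _; X]]subn0.
apply: OD0_plane is_plane16 is_line16 _ _ => [v /plane16P[x [y [z ->]]]|].
  rewrite mx_of_sym_vec; apply/eqP=> rk1; have [] := rank1_sym_mx rk1.
  rewrite mul0r !mulr0 => /eqP + /eqP + /eqP; rewrite !expf_eq0 /= => /eqP x0 /eqP z0 /eqP y0.
  by rewrite x0 y0 z0 rank_sym_mx0 in rk1.
apply: eq_card0 => P; apply/negP; rewrite inE => /andP[/pointsP[v [nz_v + ->]]].
rewrite point_rank_line // => /plane16P[x [y [z def_v]]].
rewrite def_v -memvE mem_nucleus mx_of_sym_vec eqxx andbT /= => /andP[rk2 nz_z].
(* The determinant is z^3, so z != 0 contradicts rank 2. *)
have := rank3_sym_mx char2 0 x z z y 0; rewrite (eqP rk2) !(mul0r, mulr0, add0r, addr0).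
by rewrite -exprS expf_eq0 nz_z.
Qed.

Lemma OD0_plane17 : OD0 plane17 = [:: 0; q + 1; q; q ^ 2 - q]%N.
Proof.
apply: OD0_plane is_plane17 is_line17 _ _ => [v /plane17P[x [y [z ->]]]|].
  rewrite mx_of_sym_vec; apply/eqP=> rk1; have [] := rank1_sym_mx rk1.
  rewrite !mul0r expr0n /= => /eqP + /eqP + /esym/eqP; rewrite -expr2 !expf_eq0 /=.
  by move=> /eqP x0 /eqP y0 /eqP z0; rewrite x0 y0 z0 rank_sym_mx0 in rk1.
(* Off the nucleus plane z != 0, and the determinant z (x + y)^2 vanishes exactly for x = y. Scaling
   to z = 1 leaves one point for each t in F. *)
pose w (t : F) := sym_vec 0 t t 1 0 1.
have nz_w t : w t != 0.
  by apply/eqP; rewrite -sym_vec0 => /sym_vec_inj[_ [/eqP]]; rewrite oner_eq0.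
rewrite -[RHS](card_imset (f := fun t => <[w t]>%VS)) => [|t u /eqP/line_eqP[] // k _]; last first.
  rewrite sym_vecZ => /sym_vec_inj[[_ -> _] [+ _ _]].
  by rewrite mulr1 => <-; rewrite mul1r.
have det_w x y z : 0 * z * z + 0 * 0 ^+ 2 + z * y ^+ 2 + z * x ^+ 2 = z * (x + y) ^+ 2 :> F.
  by ring: char2.
apply: eq_card => P; rewrite inE; apply/andP/imsetP => [[/pointsP[v [nz_v + ->]]]|[t _ ->]].
  rewrite point_rank_line // => /plane17P[x [y [z def_v]]].
  rewrite def_v -memvE mem_nucleus mx_of_sym_vec eqxx andbb /= => /andP[rk2 nz_z].
  have := rank3_sym_mx char2 0 x y z 0 z; rewrite (eqP rk2) det_w => /esym/negbFE.
  rewrite mulf_eq0 (negPf nz_z) expf_eq0 /= => /eqP xy.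
  have {xy} xy : x = y by rewrite -[y]addr0 -xy; ring: char2.
  exists (x / z) => //; apply/eqP/line_eqP; first by rewrite -def_v.
  by exists z; rewrite // sym_vecZ !mulr0 mulr1 mulrCA divff ?mulr1 // xy.
split; first by apply/pointsP; exists (w t); rewrite mem_plane17.
rewrite point_rank_line // -memvE mem_nucleus mx_of_sym_vec eqxx oner_eq0 andbT.
have := rank3_sym_mx char2 0 t t 1 0 1; rewrite det_w -mulr2n -mulr_natl char2 mul0r expr0n mulr0 eqxx.
have := @rank1_sym_mx F 0 t t 1 0 1; have := rank_leq_row (sym_mx 0 t t 1 0 1).
have : (0 < \rank (sym_mx (0 : F) t t 1 0 1)%R)%N.
  by rewrite lt0n -mx_of_sym_vec mxrank_eq0 mx_of_vec_eq0; exact: nz_w.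
case: (\rank _) => [|[|[|[|r]]]] // _ _ /(_ erefl)[_ _ /eqP].
by rewrite expr0n mulr1 eq_sym oner_eq0.
Qed.

End Representatives.

(** * Reduction of a plane to a representative *)

Section Classification.

Variable F : finFieldType.
Hypothesis char2 : 2 = 0 :> F.
Hypothesis sqrt_exists : forall a : F, exists s, s ^+ 2 = a.
Local Notation subspace := {vspace 'rV[F]_6}.
Local Notation N := (nucleus_plane F).
Implicit Types (v : 'rV[F]_6) (A : 'M[F]_3) (U P : subspace).

Lemma unit_mx3 (a b c d e f g h i : F) :
  (mx3 a b c d e f g h i \in unitmx) =
  (a * (e * i - f * h) - b * (d * i - f * g) + c * (d * h - e * g) != 0).
Proof. by rewrite unitmxE unitfE det_mx3. Qed.

Lemma K_act_veronese A (u : 'rV[F]_3) : K_act A (veronese_vec u) = veronese_vec (u *m A^T).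
Proof.
by rewrite /K_act !veronese_vecE vec_of_mxK ?trmx_mul ?trmxK // !mulmxA.
Qed.

Lemma K_image_disjoint A U : A \in unitmx ->
  [disjoint points U & veronese_surface F] ->
  [disjoint points (K_image A U) & veronese_surface F].
Proof.
move=> uA /disjoint_veronese disU; apply/disjoint_veronese => u nz_u.
rewrite mem_K_image // K_act_veronese disU //.
by rewrite mulmx_free_eq0 // row_free_unit unitmx_tr unitmx_inv.
Qed.

(* The matrix sym_mx 0 b c 0 e 0 has the form u w^T + w u^T for some w exactly *)
(* when u2 b + u1 c + u0 e = 0.                                                *)
Lemma nucleus_line_form U : is_line (U :&: N) ->
  exists u0 u1 u2 : F, [|| u0 != 0, u1 != 0 | u2 != 0] /\
    forall b c e, sym_vec 0 b c 0 e 0 \in U -> u2 * b + u1 * c + u0 * e = 0.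
Proof.
move/eqP=> dimL; pose L := (U :&: N)%VS; pose X := vbasis L.
(* [S] extracts the coordinates b, c, e. As [L] has dimension 2, [W] has three rows and two columns,
   and a nonzero row in its left kernel is the required linear relation. *)
pose S : 'M[F]_(6, 3) := \matrix_(k, i) (k == nth 0 [:: 1; 2; 4] i :> nat)%N%:R.
pose Y : 'M[F]_(\dim L, 6) := \matrix_j X`_j; pose W := (Y *m S)^T.
have : kermx W != 0.
  rewrite -mxrank_eq0 mxrank_ker subn_eq0 -ltnNge.
  by apply: leq_ltn_trans (rank_leq_col _) _; rewrite dimL.
rewrite -nz_row_eq0 => nz_u.
have /sub_kermxP : (nz_row (kermx W) <= kermx W)%MS by exact: nz_row_sub.
move: (nz_row _) nz_u => u nz_u uW.
exists (u 0 (inord 2)), (u 0 (inord 1)), (u 0 (inord 0)); split.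
  apply: contraNT nz_u; rewrite !negb_or !negbK => /and3P[/eqP u2 /eqP u1 /eqP u0].
  by apply/eqP/rowP; apply: ord3P; rewrite -inord3 ?u0 ?u1 ?u2 mxE.
move=> b c e Uv; set v := sym_vec _ _ _ _ _ _ in Uv.
have Lv : v \in L by rewrite memv_cap Uv mem_nucleus !eqxx.
have sLker : (L <= lker (linfun (mulmxr (S *m u^T))))%VS.
  rewrite -(span_basis (vbasisP L)); apply/span_subvP=> _ /(nthP 0)[j + <-].
  rewrite size_tuple => ltj; rewrite memv_ker lfunE /=.
  have /(congr1 (fun M => row (Ordinal ltj) M^T)) := uW.
  by rewrite trmx_mul trmxK -mulmxA row_mul rowK linear0 linear0 => ->.
have := subvP sLker v Lv; rewrite memv_ker lfunE /= mulmxA => /eqP/matrixP/(_ 0 0).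
rewrite !mxE sum_ord3 !mxE !big_ord_recl !big_ord0 !mxE /= !inord3 /=.
by rewrite !(mulr0, mulr1, add0r, addr0) => <-; ring.
Qed.

(** The parameters x and y run over the standard line of the nucleus plane, while z scales one fixed
    matrix outside that plane. *)
Definition normal_form (a d e f x y z : F) := sym_vec (z * a) x y (z * d) (z * e) (z * f).

Lemma move_nucleus_line U : is_line (U :&: N) ->
  exists2 A, A \in unitmx &
    forall b c e, (sym_vec 0 b c 0 e 0 \in K_image A U) = (e == 0).
Proof.
move=> lineU.
have [u0 [u1 [u2 [nz_u Lu]]]] := nucleus_line_form lineU.
(* In each case [A] sends the column (u0, u1, u2) to a multiple of the first basis vector, and the
   entry e of the image is a nonzero u_i times the relation. *)
have [A uA A12] : exists2 A, A \in unitmx & forall b c e, u2 * b + u1 * c + u0 * e = 0 ->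
    exists x y, K_act A (sym_vec 0 b c 0 e 0) = sym_vec 0 x y 0 0 0.
  case/or3P: nz_u => nz_ui.
  - exists (mx3 1 0 0 u1 u0 0 u2 0 u0) => [|b c e eq0].
      by rewrite unit_mx3 (_ : _ + _ = u0 * u0) ?mulf_neq0 //; ring.
    rewrite K_act_mx3 //; do 2!eexists; congr sym_vec; try by ring.
    by transitivity (u0 * (u2 * b + u1 * c + u0 * e)); [ring: char2 | rewrite eq0 mulr0].
  - exists (mx3 0 1 0 u1 u0 0 0 u2 u1) => [|b c e eq0].
      by rewrite unit_mx3 (_ : _ + _ = - (u1 * u1)) ?oppr_eq0 ?mulf_neq0 //; ring.
    rewrite K_act_mx3 //; do 2!eexists; congr sym_vec; try by ring.
    by transitivity (u1 * (u2 * b + u1 * c + u0 * e)); [ring: char2 | rewrite eq0 mulr0].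
  - exists (mx3 0 0 1 u2 0 u0 0 u2 u1) => [|b c e eq0].
      by rewrite unit_mx3 (_ : _ + _ = u2 * u2) ?mulf_neq0 //; ring.
    rewrite K_act_mx3 //; do 2!eexists; congr sym_vec; try by ring.
    by transitivity (u2 * (u2 * b + u1 * c + u0 * e)); [ring: char2 | rewrite eq0 mulr0].
exists A => // b c e.
pose L0 := (<[(sym_vec (0 : F) 1 0 0 0 0)%R]> + <[(sym_vec (0 : F) 0 1 0 0 0)%R]>)%VS.
have L0x x' y' : sym_vec 0 x' y' 0 0 0 \in L0.
  apply/memv_addP; exists (x' *: sym_vec 0 1 0 0 0 0); first by rewrite memvZ ?memv_line.
  exists (y' *: sym_vec 0 0 1 0 0 0); first by rewrite memvZ ?memv_line.
  by rewrite !sym_vecZ sym_vecD !mulr0 !mulr1 !addr0 add0r.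
have dimL0 : (\dim L0 <= 2)%N.
  by apply: leq_trans (dimv_add_leqif _ _) _; rewrite !dim_vline; do 2!case: (_ != 0).
(* The image lies in [L0], whose dimension is at most 2, so equality follows by dimension. *)
have eqL : K_image A (U :&: N) = L0.
  apply/eqP; rewrite eqEdim dim_K_image // (eqP lineU) dimL0 andbT.
  apply/subvP=> _ /memv_imgP[v /memv_capP[Uv Nv] ->]; rewrite lfunE /=.
  have [a [b' [c' [d [e' [f def_v]]]]]] := sym_vecP v.
  move: Nv Uv; rewrite {}def_v mem_nucleus => /and3P[/eqP-> /eqP-> /eqP->] /Lu/A12[x' [y' ->]].
  exact: L0x.
have -> : (sym_vec 0 b c 0 e 0 \in K_image A U) = (sym_vec 0 b c 0 e 0 \in K_image A (U :&: N)).
  by rewrite !mem_K_image // memv_cap -(mem_K_image N) // K_image_nucleus // mem_nucleus !eqxx !andbT.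
rewrite eqL; apply/memv_addP/eqP => [[_ /vlineP[k ->] [_ /vlineP[l ->]]]|->].
  by rewrite !sym_vecZ sym_vecD => /sym_vec_inj[_ [_ -> _]]; rewrite !mulr0 addr0.
by apply/memv_addP/L0x.
Qed.

Lemma plane_normal_form U : is_plane U -> is_line (U :&: N) ->
    (forall b c e, (sym_vec 0 b c 0 e 0 \in U) = (e == 0)) ->
  exists a d e f, [|| a != 0, d != 0 | f != 0] /\
    forall v, v \in U <-> exists x y z, v = normal_form a d e f x y z.
Proof.
move=> /eqP planeU /eqP lineU memL.
have /subvPn[v Uv notNv] : ~~ (U <= N)%VS.
  by apply/negP=> /capv_idPl UN; move: lineU; rewrite UN planeU.
have L0 x y : sym_vec 0 x y 0 0 0 \in U by rewrite memL.
have [a [b [c [d [e [f def_v]]]]]] := sym_vecP v.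
(* Subtracting an element of the standard line from [v] clears b and c; the plane is then its
   nucleus line plus the span of [m]. *)
pose m := sym_vec a 0 0 d e f.
have Um : m \in U.
  have -> : m = v + (-1) *: sym_vec 0 b c 0 0 0.
    by rewrite def_v sym_vecZ sym_vecD; congr sym_vec; ring.
  by rewrite memvD // memvZ.
move: notNv; rewrite def_v mem_nucleus => nz_adf.
exists a, d, e, f; split; first by rewrite -!negb_and.
have nz_m : m != 0.
  apply: contraNneq nz_adf; rewrite -sym_vec0 => /sym_vec_inj[[-> _ _] [-> _ ->]].
  by rewrite eqxx.
have defU : U = (U :&: N + <[m]>)%VS.
  apply/eqP; rewrite eq_sym eqEdim subv_add capvSl -memvE Um planeU dimv_disjoint_sum.
    by rewrite lineU dim_vline nz_m.
  apply/eqP; rewrite -subv0; apply/subvP=> w /memv_capP[/memv_capP[_ Nw] /vlineP[k def_w]].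
  move: Nw; rewrite memv0 def_w sym_vecZ mem_nucleus !mulf_eq0.
  by case: (eqVneq k 0) nz_adf => [-> _|_ /negPf->] //=; rewrite !mul0r sym_vec0 eqxx.
move=> w; split=> [|[x [y [z ->]]]].
  rewrite {1}defU => /memv_addP[n /memv_capP[Un Nn] [_ /vlineP[z ->] ->]].
  have [a' [x [y [d' [e' [f' def_n]]]]]] := sym_vecP n.
  move: Nn Un; rewrite def_n mem_nucleus => /and3P[/eqP-> /eqP-> /eqP->].
  rewrite memL => /eqP->; exists x, y, z.
  by rewrite sym_vecZ sym_vecD !mulr0 !add0r !addr0.
have -> : normal_form a d e f x y z = z *: m + sym_vec 0 x y 0 0 0.
  by rewrite sym_vecZ sym_vecD !mulr0 !add0r !addr0.
by rewrite memvD // memvZ.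
Qed.

Lemma sqrf_inj_char2 : injective (fun a : F => a ^+ 2).
Proof.
move=> a b /= eq_ab; apply/eqP; rewrite -subr_eq0.
have : (a - b) ^+ 2 == 0.
  rewrite (_ : _ ^+ 2 = a ^+ 2 - b ^+ 2 + 2 * (b ^+ 2 - a * b)); last by ring.
  by rewrite eq_ab subrr char2 mul0r addr0.
by rewrite expf_eq0.
Qed.

Lemma orbit16_or_17 U :
    [&& is_plane U, [disjoint points U & veronese_surface F] & is_line (U :&: N)] ->
  K_orbit U = K_orbit (plane16 F) \/ K_orbit U = K_orbit (plane17 F).
Proof.
move=> /and3P[planeU disU lineU].
have [A uA memL] := move_nucleus_line lineU.
have planeV : is_plane (K_image A U) by rewrite /is_plane dim_K_image.
have lineV : is_line (K_image A U :&: N).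
  rewrite /is_line -(K_image_nucleus char2 uA).
  suff -> : (K_image A U :&: K_image A N)%VS = K_image A (U :&: N) by rewrite dim_K_image.
  by apply/vspaceP=> v; rewrite memv_cap !mem_K_image // !memv_cap.
have /disjoint_veronese noV := K_image_disjoint uA disU.
rewrite -(K_orbit_K_image U uA).
move: (K_image A U) planeV lineV noV memL => V planeV lineV noV memL.
have [a [d [e [f [nz_adf memV]]]]] := plane_normal_form planeV lineV memL.
(* If e^2 = d f, the square roots of a, d, f form a vector whose Veronese image lies in [V] at z =
   1: x and y are free, and t w = e because squaring is injective. *)
have nz_det : e ^+ 2 + d * f != 0.
  apply/negP=> /eqP det0; have [s def_a] := sqrt_exists a.
  have [t def_d] := sqrt_exists d; have [w def_f] := sqrt_exists f.
  pose u : 'rV[F]_3 := \row_i [:: s; t; w]`_i.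
  have /negP[] : veronese_vec u \notin V.
    apply: noV; apply: contraTneq nz_adf => /rowP u0; rewrite -def_a -def_d -def_f.
    have := (u0 (inord 0), u0 (inord 1), u0 (inord 2)).
    by rewrite !mxE !inordK //= => -[[-> ->] ->]; rewrite expr0n /= eqxx.
  apply: (memV _).2; exists (s * t), (s * w), 1; rewrite /normal_form !mul1r veronese_vecE vec_of_mxE.
  rewrite !mxE !big_ord1 !mxE /= -!expr2 def_a def_d def_f; congr sym_vec.
  apply: sqrf_inj_char2; rewrite /= exprMn def_d def_f -[RHS]addr0 -det0; ring: char2.
(* [l] rescales a basis vector so that the diagonalised block has two equal diagonal entries. *)
have [l def_l] := sqrt_exists (e ^+ 2 + d * f)^-1.
have {}def_l : l ^+ 2 * (e ^+ 2 + d * f) = 1 by rewrite def_l mulVf.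
have nz_l : l != 0 by apply: contra_eqN def_l => /eqP->; rewrite expr0n mul0r eq_sym oner_neq0.
have eq_dim (W : subspace) : is_plane W -> \dim V = \dim W by move/eqP->; exact/eqP.
have [d0|nz_d] := eqVneq d 0; last first.
  (* The rows (0,1,0) and (0,le,ld) are orthogonal for the form [d, e; e, f] and *)
  (* both take the value d on it; adding s times row 1 to row 0 clears a.        *)
  right; have [s] := sqrt_exists (a / d); move/(congr1 ( *%R^~ d)); rewrite divfK // => def_a.
  apply: (@K_orbit_eq_of_mem _ (mx3 1 s 0 0 1 0 0 (l * e) (l * d)) _ _ _ (eq_dim _ (is_plane17 F))).
    by rewrite unit_mx3 (_ : _ + _ = l * d) ?mulf_neq0 //; ring.
  move=> v /memV[x [y [z ->]]].
  rewrite K_act_mx3 // -def_a.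
  rewrite (_ : sym_vec _ _ _ _ _ _ = sym_vec 0 (x + s * (z * d))
    (l * e * x + l * d * y + s * (z * e) * (l * d) + s * (l * e) * (z * d))
    (z * d) 0 (z * d)) ?mem_plane17 //.
  congr sym_vec; try by ring: char2.
  by transitivity (z * d * (l ^+ 2 * (e ^+ 2 + d * f))); [ring | rewrite def_l mulr1].
have [f0|nz_f] := eqVneq f 0; last first.
  (* The same reduction with the roles of d and f exchanged. *)
  right; have [s] := sqrt_exists (a / f); move/(congr1 ( *%R^~ f)); rewrite divfK // => def_a.
  apply: (@K_orbit_eq_of_mem _ (mx3 1 0 s 0 (l * f) (l * e) 0 0 1) _ _ _ (eq_dim _ (is_plane17 F))).
    by rewrite unit_mx3 (_ : _ + _ = l * f) ?mulf_neq0 //; ring.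
  move=> v /memV[x [y [z ->]]].
  rewrite K_act_mx3 // -def_a.
  rewrite (_ : sym_vec _ _ _ _ _ _ = sym_vec 0
    (l * f * x + l * e * y + s * (l * f) * (z * e) + s * (l * e) * (z * f))
    (y + s * (z * f)) (z * f) 0 (z * f)) ?mem_plane17 //.
  congr sym_vec; try by ring: char2.
  by transitivity (z * f * (l ^+ 2 * (e ^+ 2 + d * f))); [ring | rewrite def_l mulr1].
left; move: nz_adf nz_det; rewrite d0 f0 eqxx orbF mul0r addr0 expf_eq0 /= => nz_a nz_e.
(* Swapping the first two coordinates moves z a to the middle of the diagonal and z e to the corner;
   the factor a / e makes these two entries equal. *)
apply: (@K_orbit_eq_of_mem _ (mx3 0 1 0 1 0 0 0 0 (a / e)) _ _ _ (eq_dim _ (is_plane16 F))).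
  by rewrite unit_mx3 (_ : _ + _ = - (a / e)) ?oppr_eq0 ?mulf_neq0 ?invr_eq0 //; ring.
move=> v /memV[x [y [z ->]]]; rewrite d0 f0 K_act_mx3 //.
rewrite (_ : sym_vec _ _ _ _ _ _ = sym_vec 0 x (z * a) (z * a) (a / e * y) 0) ?mem_plane16 //.
by congr sym_vec; field.
Qed.

End Classification.

(** * Fields of even order, and the final assembly *)

(** The additive group is elementary abelian, so the order is a power of the characteristic. *)
Lemma char2_of_even_card (F : finFieldType) : ~~ odd #|F| -> 2 = 0 :> F.
Proof.
move=> even_q; have [p pr_p pcharFp] := finPcharP F.
have : p.-nat #|F| by rewrite -cardsT; apply: abelem_pgroup (fin_ring_pchar_abelem _).
move/(pnat_dvd (_ : (2 %| #|F|)%N)); rewrite dvdn2 pnatE // => /(_ even_q) /eqP def_p.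
by rewrite def_p (pcharf0 pcharFp).
Qed.

(** Since a^q = a, the power a^(q/2) is a square root. *)
Lemma sqrt_of_even_card (F : finFieldType) (a : F) : ~~ odd #|F| -> exists s, s ^+ 2 = a.
Proof.
move=> even_q; exists (a ^+ #|F|./2).
by rewrite -exprM muln2 halfK (negPf even_q) subn0 expf_card.
Qed.

Theorem theorem4p2 (F : finFieldType) (q : nat) (card_F : #|F| = q)
    (q_even : ~~ odd q) :
  [/\ [set K_orbit U | U : {vspace 'rV[F]_6} &
         [&& is_plane U, [disjoint points U & veronese_surface F]
           & is_line (U :&: nucleus_plane F)]] = [set Sigma16 F; Sigma17 F],
      Sigma16 F != Sigma17 F,
      Sigma16 F = [set U | is_plane U
                         & OD0 U == [:: 0; q + 1; 0; q ^ 2]%N]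
    & Sigma17 F = [set U | is_plane U
                         & OD0 U == [:: 0; q + 1; q; q ^ 2 - q]%N]].
Proof.
subst q; have char2 := char2_of_even_card q_even.
have sqrt_ex (a : F) := sqrt_of_even_card a q_even.
have q_gt0 : (0 < #|F|)%N := ltnW (finNzRing_gt1 F).
pose P16 := plane16 F; pose P17 := plane17 F.
rewrite -[Sigma16 F]/(K_orbit P16) -[Sigma17 F]/(K_orbit P17).
have OD16 := OD0_plane16 char2; have OD17 := OD0_plane17 char2.
pose cond (U : {vspace 'rV[F]_6}) := [&& is_plane U,
  [disjoint points U & veronese_surface F] & is_line (U :&: nucleus_plane F)].
have cond_OD0 (U : {vspace 'rV[F]_6}) s t :
    is_plane U -> OD0 U = [:: 0; #|F| + 1; s; t]%N -> cond U.
  move=> planeU OD; rewrite /cond planeU disjoint_veronese_OD0 ?OD //=.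
  by apply: is_line_card_points; move/(congr1 (nth 0%N ^~ 1%N)): OD.
have orbit_inv (U V : {vspace 'rV[F]_6}) :
    V \in K_orbit U -> is_plane V = is_plane U /\ OD0 V = OD0 U.
  by case/K_orbitP=> A uA ->; rewrite /is_plane dim_K_image // OD0_K_image.
have neq_OD0 s t s' t' : s != s' -> [:: 0; #|F| + 1; s; t]%N <> [:: 0; #|F| + 1; s'; t']%N.
  by move=> /eqP neq_s [].
(* Stated for an abstract pair [P], [Q] so that it serves both orbits: a plane with the distribution
   of [P] is admissible, and the third entry keeps it out of the orbit of [Q]. *)
have orbitE (P Q U : {vspace 'rV[F]_6}) s t s' t' : s != s' ->
    is_plane P -> OD0 P = [:: 0; #|F| + 1; s; t]%N -> OD0 Q = [:: 0; #|F| + 1; s'; t']%N ->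
    (forall V, cond V -> K_orbit V = K_orbit P \/ K_orbit V = K_orbit Q) ->
  (U \in K_orbit P) = is_plane U && (OD0 U == [:: 0; #|F| + 1; s; t]%N).
  move=> neq_s planeP ODP ODQ orbits; apply/idP/andP => [/orbit_inv[-> ->]|[planeU /eqP ODU]].
    by rewrite planeP ODP.
  have [<-|eqQ] := orbits U (cond_OD0 _ _ _ planeU ODU); first exact: K_orbit_refl.
  have /orbit_inv[_] : U \in K_orbit Q by rewrite -eqQ K_orbit_refl.
  by rewrite ODU ODQ => /(neq_OD0 _ _ _ _ neq_s).
have orbits V : cond V -> K_orbit V = K_orbit P16 \/ K_orbit V = K_orbit P17.
  exact: orbit16_or_17.
split.
- apply/setP=> O; rewrite !inE; apply/imsetP/orP => [[U]|].
    by rewrite inE => /orbits[] -> ->; [left | right].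
  case=> /eqP->; [exists P16 | exists P17] => //; rewrite inE.
    exact: cond_OD0 (is_plane16 F) OD16.
  exact: cond_OD0 (is_plane17 F) OD17.
- apply/eqP=> eq_orb; have /orbit_inv[_] : P16 \in K_orbit P17 by rewrite -eq_orb K_orbit_refl.
  by rewrite OD16 OD17; apply: neq_OD0; rewrite eq_sym -lt0n.
- apply/setP=> U; rewrite inE.
  by apply: orbitE (is_plane16 F) OD16 OD17 orbits; rewrite eq_sym -lt0n.
- apply/setP=> U; rewrite inE.
  apply: orbitE (is_plane17 F) OD17 OD16 _; first by rewrite -lt0n.
  by move=> V /orbits[]; [right | left].
Qed.
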